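(* Let $k,a,n$ be integers with $k\ge 1$ and $n\ge a\ge 0$. If $a<\partial^{k+1}(n)$, then $\partial^{k}(a)+\partial^{k+1}(n-a)\ge \partial^{k+1}(n)$. Moreover, if $n=\binom{N}{k+1}$ for some $N\ge k+1$, then equality in $\partial^{k}(a)+\partial^{k+1}(n-a)\ge \partial^{k+1}(n)$ holds only when $a=0$.
   Context: Given integers $k\ge 1$ and $n\ge 0$, write $n$ uniquely as $n=\binom{n_k}{k}+\binom{n_{k-1}}{k-1}+\dots+\binom{n_1}{1}$ with $0\le n_1<n_2<\dots<n_k$ (the $k$-binomial representation of $n$). The Kruskal-Macaulay function is $\partial^{k}(n)=\binom{n_k-1}{k-1}+\binom{n_{k-1}-1}{k-2}+\dots+\binom{n_1-1}{0}$. *)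

(* Defs.v *)
From mathcomp Require Import all_boot.

Set Implicit Arguments.
Unset Strict Implicit.
Unset Printing Implicit Defensive.

(* [m i] is the n_(i+1) of the usual notation
   n = 'C(n_k, k) + ... + 'C(n_1, 1) with 0 <= n_1 < ... < n_k. *)
Definition binomial_rep (k n : nat) (m : {ffun 'I_k -> nat}) : bool :=
  [forall i : 'I_k, forall j : 'I_k, (i < j) ==> (m i < m j)]
  && (n == \sum_(i < k) 'C(m i, i.+1)).

Lemma binomial_rep_exists_fun (k n : nat) :
  exists f : nat -> nat,
    (forall i j, i < j -> j < k.+1 -> f i < f j) /\
    n = \sum_(i < k.+1) 'C(f i, i.+1).
Proof.
elim: k n => [|k IHk] n.
  exists (fun=> n); split; last by rewrite big_ord1 bin1.
  by move=> i [|j].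
have ex0 : exists M, 'C(M, k.+2) <= n by exists 0.
have bnd M : 'C(M, k.+2) <= n -> M <= n + k.+2.
  move=> hM; rewrite leqNgt; apply/negP=> hlt.
  have le_bin : forall p, p < 'C(p + k.+2, k.+2).
    elim=> [|p IHp]; first by rewrite add0n binn.
    rewrite addSn binS -addn1 leq_add //.
    by rewrite bin_gt0 addnS -addSn leq_addl.
  have := leq_trans (le_bin n) (leq_bin2l k.+2 (ltnW hlt)).
  by rewrite ltnNge hM.
case: (ex_maxnP ex0 bnd) => M hM maxM.
have [f [fS fE]] := IHk (n - 'C(M, k.+2)).
have fk : f k < M.
  have h1 : 'C(f k, k.+1) <= n - 'C(M, k.+2).
    by rewrite fE big_ord_recr /= leq_addl.
  have h2 : n - 'C(M, k.+2) < 'C(M, k.+1).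
    rewrite ltn_subLR // -binS ltnNge; apply/negP=> /maxM.
    by rewrite ltnn.
  rewrite ltnNge; apply/negP=> /(leq_bin2l k.+1) h3.
  by have := leq_ltn_trans (leq_trans h3 h1) h2; rewrite ltnn.
exists (fun i => if i == k.+1 then M else f i); split.
  move=> i j ij jk; have ik : i < k.+1 by apply: leq_trans ij _.
  rewrite (ltn_eqF ik); case: eqP => [_|/eqP nj].
    by move: ik; rewrite ltnS leq_eqVlt => /predU1P[->//|ik];
       apply: ltn_trans (fS _ _ ik _) fk.
  by apply: fS => //; rewrite ltn_neqAle nj.
rewrite big_ord_recr /= eqxx.
under eq_bigr => i _ do rewrite (ltn_eqF (ltn_ord i)).
by rewrite -fE subnK.
Qed.

Lemma binomial_rep_exists (k n : nat) :
  exists m : {ffun 'I_k.+1 -> nat}, binomial_rep n m.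
Proof.
have [f [fS fE]] := binomial_rep_exists_fun k n.
exists [ffun i : 'I_k.+1 => f i]; apply/andP; split.
  by apply/'forall_forallP=> i j; apply/implyP=> ij; rewrite !ffunE fS.
by apply/eqP; rewrite {1}fE; apply: eq_bigr => i _; rewrite ffunE.
Qed.

Lemma binomial_rep_lt_fun (f : nat -> nat) (k : nat) :
  (forall i j, i < j -> j < k.+1 -> f i < f j) ->
  \sum_(i < k.+1) 'C(f i, i.+1) < 'C((f k).+1, k.+1).
Proof.
elim: k => [|k IHk] fS; first by rewrite big_ord1 !bin1.
rewrite big_ord_recr /= binS addnC ltn_add2l.
apply: leq_trans (leq_bin2l _ (fS k k.+1 _ _)) => //.
by apply: IHk => i j ij jk; apply: fS => //; apply: ltnW.
Qed.

Lemma binomial_rep_uniq_fun (f g : nat -> nat) (k : nat) :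
  (forall i j, i < j -> j < k -> f i < f j) ->
  (forall i j, i < j -> j < k -> g i < g j) ->
  \sum_(i < k) 'C(f i, i.+1) = \sum_(i < k) 'C(g i, i.+1) ->
  forall i, i < k -> f i = g i.
Proof.
elim: k => [//|k IHk] fS gS E.
have top (u v : nat -> nat) :
    (forall i j, i < j -> j < k.+1 -> u i < u j) ->
    \sum_(i < k.+1) 'C(u i, i.+1) = \sum_(i < k.+1) 'C(v i, i.+1) ->
    v k <= u k.
  move=> uS uv; rewrite leqNgt; apply/negP=> /(leq_bin2l k.+1) h.
  have := leq_trans (binomial_rep_lt_fun uS) h.
  by rewrite uv big_ord_recr /= ltnNge leq_addl.
have fgk : f k = g k by apply/eqP; rewrite eqn_leq (top g f) // (top f g).
move=> i; rewrite ltnS leq_eqVlt => /predU1P[->//|ik].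
apply: IHk => // [p q pq qk|p q pq qk|].
- by apply: fS => //; apply: ltnW.
- by apply: gS => //; apply: ltnW.
by move: E; rewrite !big_ord_recr /= fgk => /addIn.
Qed.

Lemma binomial_rep_uniq (k n : nat) (m1 m2 : {ffun 'I_k.+1 -> nat}) :
  binomial_rep n m1 -> binomial_rep n m2 -> m1 = m2.
Proof.
move=> /andP[/'forall_forallP S1 /eqP E1] /andP[/'forall_forallP S2 /eqP E2].
have mS (m : {ffun 'I_k.+1 -> nat}) :
    (forall i j : 'I_k.+1, (i < j) ==> (m i < m j)) ->
    forall i j, i < j -> j < k.+1 -> m (inord i) < m (inord j).
  move=> hS i j ij jk; apply: (implyP (hS _ _)).
  by rewrite !inordK // (ltn_trans ij jk).
have mE (m : {ffun 'I_k.+1 -> nat}) :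
    \sum_(i < k.+1) 'C(m i, i.+1) = \sum_(i < k.+1) 'C(m (inord i), i.+1).
  by apply: eq_bigr => i _; rewrite inord_val.
apply/ffunP=> i; rewrite -(inord_val i).
apply: (binomial_rep_uniq_fun (mS _ S1) (mS _ S2) _ (ltn_ord i)).
by rewrite -!mE -E1 -E2.
Qed.

(* 'C(p - 1, q) for the integer p - 1 >= -1, with 'C(-1, q) = 0 for all q,
   including q = 0 (truncated subtraction would give 'C(0.-1, 0) = 1). It is
   only used at p = 0 for n_1 = 0, and makes the function below vanish at 0. *)
Definition bin_pred (p q : nat) : nat := if p is p'.+1 then 'C(p', q) else 0.

(* The Kruskal-Macaulay function; the value at k = 0 is irrelevant. *)
Definition kruskal_macaulay (k n : nat) : nat :=
  if k is k'.+1 then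
    let m := xchoose (binomial_rep_exists k' n) in
    \sum_(i < k'.+1) bin_pred (m i) i
  else 0.

Lemma kruskal_macaulayE (k n : nat) (m : {ffun 'I_k.+1 -> nat}) :
  binomial_rep n m ->
  kruskal_macaulay k.+1 n = \sum_(i < k.+1) bin_pred (m i) i.
Proof.
by move=> hm; rewrite /= (binomial_rep_uniq (xchooseP _) hm).
Qed.

(* Main.v *)
Require Import Defs.
From mathcomp Require Import all_boot zify.

(* Put f_k := \partial^k. On [0, 'C(M, k)] the increments of f_k form a 0/1 word
   D_k(M), and D_k(M) is the concatenation of D_k(M-1) and D_(k-1)(M-1). Hence
   reversing and complementing D_k(M) gives D_(M-k)(M), and this duality turns
   subadditivity f_k(x+y) <= f_k(x) + f_k(y) into
     f_k(T) + f_k(x+y-T) <= f_k(x) + f_k(y)   for x, y <= T = 'C(M, k) <= x+y.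
   Both follow from a simultaneous induction on M.
   For the theorem write n = 'C(m, k+1) + r with r < 'C(m, k). If a <= r, the
   claim is subadditivity of f_k. Otherwise, with a = r + s and T = 'C(m-1, k),
   it reads f_k(T) + f_k(r) <= f_k(r+s) + f_k(T-s): for r + s <= T this is the
   dual inequality, and for r + s = T + u it is the theorem for (k-1, u, r). *)

Local Notation km := kruskal_macaulay.

(** * Pascal recursion and duality *)

Lemma km_sum (k : nat) (f : nat -> nat) :
  (forall i j, i < j -> j < k.+1 -> f i < f j) ->
  km k.+1 (\sum_(i < k.+1) 'C(f i, i.+1)) = \sum_(i < k.+1) bin_pred (f i) i.
Proof.
move=> fS; rewrite (@kruskal_macaulayE _ _ [ffun i : 'I_k.+1 => f i]).
  by apply: eq_bigr => i _; rewrite ffunE.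
apply/andP; split.
  by apply/'forall_forallP=> i j; apply/implyP=> ij; rewrite !ffunE fS.
by apply/eqP/eq_bigr => i _; rewrite ffunE.
Qed.

Lemma km0 (k : nat) : km k 0 = 0.
Proof.
case: k => // k; have := @km_sum k id (fun _ _ ij _ => ij).
rewrite big1 => [->|i _]; last by rewrite bin_small.
by rewrite big1 // => -[[|i] ?] _ //=; rewrite bin_small.
Qed.

(** The bound on [r] keeps its top entry below [m.+1], so adjoining [m.+1] yields the representation
    of the sum. *)
Lemma km_add_lt (k m r : nat) :
  r < 'C(m.+1, k) -> km k.+1 ('C(m.+1, k.+1) + r) = 'C(m, k) + km k r.
Proof.
case: k => [|k] hr.
  have -> : r = 0 by move: hr; rewrite bin0; lia.
  have := @km_sum 0 (fun=> m.+1); rewrite !big_ord1 /= !addn0 => -> //.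
  by move=> i [|j].
have [f [fS fE]] := binomial_rep_exists_fun k r.
have fk : f k < m.+1.
  rewrite ltnNge; apply/negP => /(leq_bin2l k.+1); apply/negP.
  by rewrite -ltnNge; apply: leq_ltn_trans hr; rewrite fE big_ord_recr leq_addl.
pose g i := if i == k.+1 then m.+1 else f i.
have gS i j : i < j -> j < k.+2 -> g i < g j.
  move=> ij jk; rewrite /g (ltn_eqF (leq_trans ij _)) //.
  case: (ltngtP j k.+1) => [jk'|jk'|jk']; [exact: fS|lia|].
  have [->//|ik] := eqVneq i k; apply: ltn_trans fk.
  by apply: fS; lia.
have gk : g k.+1 = m.+1 by rewrite /g eqxx.
have gf (i : 'I_k.+1) : g i = f i by rewrite /g (ltn_eqF (ltn_ord i)).
have sum_bin : \sum_(i < k.+1) 'C(g i, i.+1) = r.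
  by rewrite fE; apply: eq_bigr => i _; rewrite gf.
have sum_pred : \sum_(i < k.+1) bin_pred (g i) i = km k.+1 r.
  by rewrite fE km_sum //; apply: eq_bigr => i _; rewrite gf.
have := km_sum _ _ gS.
by rewrite big_ord_recr [in RHS]big_ord_recr sum_bin sum_pred gk /= addnC => ->;
   rewrite addnC.
Qed.

Lemma km_bin (k m : nat) : km k.+1 'C(m.+1, k.+1) = 'C(m, k).
Proof.
case: (leqP k m.+1) => km1.
  by rewrite -[X in km _ X]addn0 km_add_lt ?bin_gt0 // km0 addn0.
by rewrite !bin_small ?km0; lia.
Qed.

Lemma km_add (k m r : nat) : r <= 'C(m.+1, k) ->
  km k.+1 ('C(m.+1, k.+1) + r) = km k.+1 'C(m.+1, k.+1) + km k r.
Proof.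
rewrite km_bin leq_eqVlt => /predU1P[->|]; last exact: km_add_lt.
rewrite -binS km_bin; case: k => [|k]; first by rewrite !bin0.
by rewrite km_bin binS.
Qed.

Lemma km1 (k : nat) : km k.+1 1 = 1.
Proof. by rewrite -[X in km _ X](binn k.+1) km_bin binn. Qed.

Lemma bin_decomp (k n : nat) : 0 < n ->
  exists m r, [/\ n = 'C(m.+1, k.+1) + r, k <= m & r < 'C(m.+1, k)].
Proof.
elim: n => // -[_ _|n IHn _].
  by exists k, 0; rewrite binn addn0 bin_gt0.
have [//|m [r [-> le_km]]] := IHn; rewrite leq_eqVlt => /predU1P[er|hr].
  exists m.+1, 0; rewrite [in RHS]binS bin_gt0 -er addn0 addnS; split=> //; lia.
by exists m, r.+1; rewrite addnS.
Qed.

(* The 0/1 word of increments of [km i] on [0, 'C(i + j, i)], reversed and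
   complemented, is that of [km j]: the Pascal recursion [km_add] of the two
   words is the same, with the two factors exchanged. *)
Lemma km_dual (i j x y : nat) : 0 < i + j -> x + y = 'C(i + j, i) ->
  km i x + y = km i 'C(i + j, i) + km j y.
Proof.
have [p] := ubnP (i + j); elim: p i j x y => // p IHp i j x y hp hij.
case: i hij hp => [|i] hij hp.
  case: j hij hp => // j _ _; rewrite bin0 -![km 0 _]/0.
  by case: y => [|[|y]]; rewrite ?km0 ?km1; lia.
case: j hij hp => [|j] hij hp.
  rewrite addn0 binn -![km 0 _]/0.
  by case: x => [|[|x]]; rewrite ?km0 ?km1; lia.
rewrite addSn binS addnS.
(* Binomial symmetry: the two blocks for [j.+1] have the lengths of those for [i.+1], in the
   opposite order. *)
have eqC : 'C((i + j).+1, j.+1) = 'C((i + j).+1, i).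
  by rewrite -addnS -bin_sub ?leq_addl // addnK.
have eqC' : 'C((i + j).+1, j) = 'C((i + j).+1, i.+1).
  by rewrite -addSn -bin_sub ?leq_addl // addnK.
set L := 'C((i + j).+1, i.+1); set L1 := 'C((i + j).+1, i) => exy.
have dual1 x' y' : x' + y' = L -> km i.+1 x' + y' = km i.+1 L + km j y'.
  by rewrite /L -addSn; apply: IHp => //; lia.
have dual2 x' y' : x' + y' = L1 -> km i x' + y' = km i L1 + km j.+1 y'.
  by rewrite /L1 -addnS; apply: IHp => //; lia.
rewrite km_add ?leqnn // -/L -/L1.
case: (leqP x L) => [xL|Lx].
  have [y0 ey] : exists y0, y = L1 + y0 by exists (y - L1); lia.
  have := @km_add j (i + j) y0; rewrite eqC eqC' -/L -/L1 -ey => ->; last by lia.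
  have := dual1 x y0; have := dual2 0 L1; rewrite km0; lia.
have [x0 ex] : exists x0, x = L + x0 by exists (x - L); lia.
rewrite ex km_add -/L -/L1; last by lia.
by have := dual2 x0 y; lia.
Qed.

(** * Subadditivity and its dual *)

Definition km_subadd_on (M : nat) : Prop := forall k x y,
  x + y <= 'C(M, k) -> km k (x + y) <= km k x + km k y.

(* The image of subadditivity under [km_dual]. *)
Lemma km_supermod_on (M : nat) : km_subadd_on M.+1 -> forall k x y z,
  x <= 'C(M.+1, k) -> y <= 'C(M.+1, k) -> x + y = 'C(M.+1, k) + z ->
  km k 'C(M.+1, k) + km k z <= km k x + km k y.
Proof.
move=> S k x y z; case: (leqP k M.+1) => [le_kM|lt_Mk]; last first.
  by rewrite bin_small //; case: x => // _; case: y => // _; rewrite !add0n => <-; rewrite km0.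
have [j ej] : exists j, M.+1 = k + j by exists (M.+1 - k); lia.
set T := 'C(_, _) => xT yT exy.
have eT : T = 'C(k + j, k) by rewrite /T ej.
have dual x' y' : x' + y' = T -> km k x' + y' = km k T + km j y'.
  by rewrite eT; apply: km_dual; lia.
(* The complements add up to [T - z], so subadditivity of [km j] applies; [dual] carries it back. *)
have := S j (T - x) (T - y).
have -> : 'C(M.+1, j) = T by rewrite /T ej -[RHS]bin_sub ?leq_addr // addKn.
have := dual x (T - x); have := dual y (T - y).
have := dual z (T - x + (T - y)); lia.
Qed.

(** Subadditivity splits off the leading term of [y] in index [k.+1]. The remainder [r] contributes
    [km k r] to both sides, and Pascal's rule settles the binomial. *)
Lemma km_mono_index_on (M : nat) : km_subadd_on M -> forall k y,
  y <= 'C(M, k) -> km k y <= km k.+1 y.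
Proof.
move=> S k y yM; case: (posnP y) => [->|y0]; first by rewrite km0.
have bin_case m : 'C(m.+1, k.+1) <= 'C(M, k) ->
    km k 'C(m.+1, k.+1) <= 'C(m, k).
  elim: m => [|m IHm].
    by case: k S yM => [//|k] S yM; rewrite bin_small ?km0.
  case: k S yM IHm => [//|k] S yM IHm; rewrite binS => hC.
  apply: leq_trans (S _ _ _ hC) _; rewrite km_bin binS leq_add2r.
  by apply: IHm; apply: leq_trans hC; rewrite leq_addr.
have [m [r [ey le_km hr]]] := bin_decomp k y y0.
rewrite ey km_add ?km_bin; last exact: ltnW.
apply: leq_trans (S _ _ _ _) _; first by rewrite -ey.
by rewrite leq_add2r bin_case //; apply: leq_trans yM; rewrite ey leq_addr.
Qed.

(** Split at the end [L] of the first Pascal block. If [x] reaches it, the second block reduces to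
    index [k]; if only the sum passes it, [km_supermod_on] applies to [x] and [y] in the first
    block. [km_mono_index_on] pays for the change of index. *)
Lemma km_subadd_onP (M : nat) : km_subadd_on M.
Proof.
elim: M => [|M IHM] k x y.
  by case: x => [|x]; case: y => [|y]; rewrite ?km0 ?addn0 //; case: k => //=; lia.
wlog le_yx : x y / y <= x => [W|].
  by case: (leqP y x) => [/W//|/ltnW/W]; rewrite addnC [km k x + _]addnC.
case: k => [//|k]; case: M IHM => [|M] IHM.
  case: y le_yx => [|y]; rewrite ?addn0 ?leq_addr // binS bin0n.
  by case: k => [|k] /=; rewrite ?bin0n /=; lia.
rewrite binS => hxy; set L := 'C(M.+1, k.+1) in hxy.
case: (leqP (x + y) L) => [xyL|Lxy]; first exact: IHM.
case: (leqP L x) => [Lx|xL].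
  have [x0 ex] : exists x0, x = L + x0 by exists (x - L); lia.
  rewrite ex -addnA !km_add; try lia.
  rewrite -!addnA leq_add2l; apply: leq_trans (IHM _ _ _ _) _; first by lia.
  by rewrite leq_add2l; apply: (km_mono_index_on _ IHM); lia.
have [v ev] : exists v, x + y = L + v by exists (x + y - L); lia.
rewrite ev km_add; last by lia.
apply: leq_trans (km_supermod_on _ IHM _ _ _ _ (ltnW xL) _ ev); last first.
  by rewrite -/L; lia.
by rewrite leq_add2l; apply: (km_mono_index_on _ IHM); lia.
Qed.

Lemma leq_bin_add (k p : nat) : p < 'C(p + k.+1, k.+1).
Proof.
elim: p => [|p IHp]; first by rewrite add0n binn.
by rewrite addSn binS -addn1 leq_add // bin_gt0 addnS -addSn leq_addl.
Qed.

Lemma km_subadd (k x y : nat) : km k (x + y) <= km k x + km k y.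
Proof.
case: k => [//|k]; apply: (@km_subadd_onP (x + y + k.+1)).
exact/ltnW/leq_bin_add.
Qed.

Lemma km_supermod (k m x y z : nat) :
  x <= 'C(m.+1, k) -> y <= 'C(m.+1, k) -> x + y = 'C(m.+1, k) + z ->
  km k 'C(m.+1, k) + km k z <= km k x + km k y.
Proof. exact/km_supermod_on/km_subadd_onP. Qed.

(** * Size bounds, runs of increments and strictness *)

Lemma km_add_le (k x y : nat) : km k (x + y) <= km k x + y.
Proof.
case: k => [//|k]; elim: y => [|y IHy]; first by rewrite !addn0.
rewrite addnS -(addn1 (x + y)); apply: leq_trans (km_subadd _ _ _) _.
by rewrite km1; lia.
Qed.

Lemma km_le (k x : nat) : km k x <= x.
Proof. by have := km_add_le k 0 x; rewrite km0 !add0n. Qed.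

(** The word of increments ends in 0 because its dual word starts with 1. *)
Lemma km_bin_pred (k m : nat) : k <= m ->
  km k 'C(m.+1, k).-1 = km k 'C(m.+1, k).
Proof.
move=> le_km; have [j ej] : exists j, m = k + j by exists (m - k); lia.
have := @km_dual k j.+1 'C(m.+1, k).-1 1; rewrite addnS -ej km1.
have : 0 < 'C(m.+1, k) by rewrite bin_gt0 ltnW.
lia.
Qed.

Lemma km_le_bin (k m r : nat) : r <= 'C(m.+1, k) -> km k r <= km k 'C(m.+1, k).
Proof.
case: (leqP k m.+1) => [le_km hr|lt_mk]; last by rewrite bin_small; case: r.
have [j ej] : exists j, m.+1 = k + j by exists (m.+1 - k); lia.
have := @km_dual k j r ('C(m.+1, k) - r); rewrite -ej.
by have := km_le j ('C(m.+1, k) - r); lia.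
Qed.

Lemma km_id (k s : nat) : s <= k -> km k s = s.
Proof.
have kk : km k k = k.
  elim: k => // k IHk.
  have := @km_add k k k; rewrite binn binSn km1 IHk add1n; lia.
move=> sk; have := km_add_le k s (k - s); have := km_le k s.
by rewrite subnKC // kk; lia.
Qed.

(* The word of increments of [km k] starts with k ones and has no other run of
   that length. *)
Lemma km_no_run (k s : nat) : 0 < k -> 0 < s -> km k (s + k) < km k s + k.
Proof.
case: k => // k _; elim: k s => [|k IHk] s s0.
  have [m [r [es _ hr]]] := bin_decomp 0 s s0.
  have := @km_bin 0 m; have := @km_bin 0 m.+1; move: es hr.
  rewrite !bin1 !bin0 => es hr; have -> : s = m.+1 by lia.
  by rewrite addn1; lia.
have [m [r [es le_km hr]]] := bin_decomp k.+1 s s0.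
have hE : 'C(m.+2, k.+2) = 'C(m.+1, k.+2) + 'C(m.+1, k.+1) by rewrite binS.
(* If the window reaches the end of the block, it contains the zero increment of [km_bin_pred]. *)
case: (leqP 'C(m.+2, k.+2) (s + k.+2)) => hs.
  have := @km_bin_pred k.+2 m.+1 le_km.
  have := km_add_le k.+2 'C(m.+2, k.+2) (s + k.+2 - 'C(m.+2, k.+2)).
  have := km_add_le k.+2 s ('C(m.+2, k.+2).-1 - s).
  by rewrite !subnKC; lia.
(* Now the window lies in the second block, of index [k.+1]; for [r = 0] it starts that block, which
   begins with exactly [k.+1] ones. *)
rewrite es -addnA !km_add; try lia.
rewrite -addnA ltn_add2l; case: (posnP r) => [->|r0].
  by have := @km_bin k k.+1; rewrite km0 !binSn add0n; lia.
have := IHk r r0; have := km_add_le k.+1 (r + k.+1) 1.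
by rewrite -addnA addn1; lia.
Qed.

(** Equality forces [s] and [x] below [k], where [km k] is the identity; then [km k] would fix
    ['C(m.+1, k)], against the final zero increment. *)
Lemma km_strict (k m s x : nat) : 0 < k -> k <= m.+1 ->
  0 < s -> 0 < x -> s + x = 'C(m.+1, k) ->
  km k 'C(m.+1, k) < km k s + km k x.
Proof.
move=> k0 le_km s0 x0 eT; rewrite ltnNge; apply/negP => hle.
have le_km' : k <= m.
  by rewrite -ltnS ltn_neqAle le_km andbT; apply/eqP => ekm;
     move: eT; rewrite ekm binn; lia.
(* Equality in subadditivity would make the prefix of length k, which consists
   of ones, reappear at s (or at x). *)
have run u v : 0 < u -> u + v = 'C(m.+1, k) ->
    km k u + km k v <= km k 'C(m.+1, k) -> v < k.
  move=> u0 euv huv; rewrite ltnNge; apply/negP => kv.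
  have := @km_supermod k m (u + k) v k; have := km_no_run k u k0 u0.
  by rewrite (km_id k k) //; lia.
have xk := run s x s0 eT hle.
have sk : s < k by apply: (run x s); rewrite 1?addnC.
have := km_bin_pred k m le_km'; have := km_le k 'C(m.+1, k).-1.
by move: hle; rewrite (km_id _ _ (ltnW sk)) (km_id _ _ (ltnW xk)); lia.
Qed.

(** * The inequality and its equality case *)

Lemma km_ineq (k a n : nat) : a <= n -> a < km k.+1 n ->
  km k.+1 n <= km k a + km k.+1 (n - a).
Proof.
elim: k a n => [|k IHk] a n le_an lt_a.
  case: (posnP n) => [n0|n0]; first by move: lt_a; rewrite n0 km0.
  have [m [r [en _ hr]]] := bin_decomp 0 n n0.
  (* [km 1] takes the value 1 at every positive integer. *)
  have -> : a = 0.
    by move: lt_a; rewrite en km_add_lt // bin0 -[km 0 _]/0; lia.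
  by rewrite subn0 leq_addl.
case: (posnP n) => [n0|n0]; first by move: lt_a; rewrite n0 km0.
have [m [r [en le_km hr]]] := bin_decomp k.+1 n n0.
case: m => [//|m] in en le_km hr *.
have gn : km k.+2 n = 'C(m.+1, k.+1) + km k.+1 r.
  by rewrite en km_add ?km_bin // ltnW.
have := km_le k.+1 r => le_r.
case: (leqP a r) => [le_ar|lt_ra].
  have -> : n - a = 'C(m.+2, k.+2) + (r - a) by lia.
  rewrite gn km_add ?km_bin; last by lia.
  by have := km_subadd k.+1 a (r - a); rewrite subnKC //; lia.
have [s ea] : exists s, a = r + s by exists (a - r); lia.
set T := 'C(m.+1, k.+1) in gn *.
(* Since [a < T + km k.+1 r <= T + r], one has [s < T]: only the second Pascal block of the leading
   binomial is cut. *)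
have -> : n - a = 'C(m.+1, k.+2) + (T - s) by rewrite en binS -/T; lia.
rewrite km_add -/T; last by lia.
suff : km k.+1 T + km k.+1 r <= km k.+1 a + km k.+1 (T - s).
  by rewrite gn !km_bin /T binS; lia.
case: (leqP a T) => [aT|Ta]; first by apply: km_supermod; lia.
have [u eu] : exists u, a = T + u by exists (a - T); lia.
(* The bound on [a] descends to the hypothesis of the induction for [u] and [r]. *)
have hu : u < km k.+1 r by lia.
have hu' : u <= 'C(m.+1, k).
  have := @km_le_bin k.+1 m.+1 r (ltnW hr); rewrite km_bin; lia.
rewrite eu km_add // -/T -addnA leq_add2l.
have -> : T - s = r - u by lia.
by apply: IHk => //; lia.
Qed.

Theorem theorem1 (k a n : nat) (hk : 1 <= k) (han : a <= n)
    (ha : a < kruskal_macaulay k.+1 n) :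
  kruskal_macaulay k a + kruskal_macaulay k.+1 (n - a)
    >= kruskal_macaulay k.+1 n /\
  (forall N : nat, k.+1 <= N -> n = 'C(N, k.+1) ->
     kruskal_macaulay k a + kruskal_macaulay k.+1 (n - a)
       = kruskal_macaulay k.+1 n ->
     a = 0).
Proof.
split=> [|N le_kN en]; first exact: km_ineq.
case: k hk ha le_kN en => // k _ ha le_kN en.
case: N => [//|[|m]] in le_kN en *; first by lia.
case: (posnP a) => // a0 eqn; exfalso; move: eqn ha.
rewrite en km_bin => + ha; set T := 'C(m.+1, k.+1) in ha *.
have -> : 'C(m.+2, k.+2) - a = 'C(m.+1, k.+2) + (T - a).
  by rewrite binS -/T; lia.
rewrite km_add -/T ?leq_subr // km_bin => eqn.
(* Here [ha] reads [a < T], and equality would make subadditivity sharp at [T = a + (T - a)]. *)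
have := @km_strict k.+1 m a (T - a) isT le_kN a0.
by rewrite -/T km_bin; have := binS m k; lia.
Qed.
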